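(* Let $\mathbb P$ be a property of Noetherian local rings. Then the following statements hold: (1) If $\mathbb P$ satisfies the Nagata criterion (NC), then $\mathbb P$ satisfies (A-3). (2) If $\mathbb P$ satisfies (A-1), (A-2), and (A-3), then $\mathbb P$ satisfies the Nagata criterion (NC).
   Context: All rings are commutative with identity. Properties of rings are understood to be invariant under ring isomorphism. For a property $\mathbb P$ of Noetherian local rings and a Noetherian ring $A$, put $\mathbb P(A)=\{\mathfrak p\in\operatorname{Spec}(A)\mid A_{\mathfrak p}\text{ satisfies }\mathbb P\}$. A Noetherian ring $A$ satisfies $\mathbb P$-Q0 if $\mathbb P(A/\mathfrak p)$ contains a nonempty open subset of $\operatorname{Spec}(A/\mathfrak p)$ for every $\mathfrak p\in\operatorname{Spec}(A)$. (NC): for every Noetherian ring $A$, if $A$ satisfies $\mathbb P$-Q0 then $\mathbb P(A)$ is open in $\operatorname{Spec}(A)$. (A-1): for any Noetherian ring $A$ and any prime ideals $\mathfrak q\subseteq\mathfrak p$ of $A$, if $A_{\mathfrak p}$ satisfies $\mathbb P$, then $A_{\mathfrak q}$ satisfies $\mathbb P$. (A-2): for any Noetherian ring $A$ and any $P\in\mathbb P(A)$, setting $n=\operatorname{ht}(P)$, there exist elements $x_1,\ldots,x_n\in P$ such that, with $I=(x_1,\ldots,x_n)$: (i) the sequence $x_1/1,\ldots,x_n/1$ is an $A_P$-regular sequence and $\sqrt{IA_P}=PA_P$; (ii) $P/I\in\mathbb P(A/I)$, equivalently $A_P/IA_P$ satisfies $\mathbb P$; (iii) there exists an open neighbourhood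 $W$ of $P$ in $\operatorname{Spec}(A)$ such that, for any $Q\in W\cap V(P)$, if $A_Q/IA_Q$ satisfies $\mathbb P$, then $A_Q$ satisfies $\mathbb P$. (A-3): for any Noetherian ring $A$ satisfying $\mathbb P$-Q0 and any prime ideal $\mathfrak p\in\mathbb P(A)$ such that $\mathfrak p^r=0$ for some integer $r\ge 1$ and such that $\mathfrak p^i/\mathfrak p^{i+1}$ is a free $A/\mathfrak p$-module of finite rank for all $i=0,\ldots,r-1$, there exists an open neighbourhood $U$ of $\mathfrak p$ in $\operatorname{Spec}(A)$ such that, for any $\mathfrak q\in U$, if $A_{\mathfrak q}/\mathfrak pA_{\mathfrak q}$ satisfies $\mathbb P$, then $A_{\mathfrak q}$ satisfies $\mathbb P$. *)

(* Defs.v *)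
(* Rings are [comPzRingType]s, so that the zero ring is allowed. *)
From HB Require Import structures.
From mathcomp Require Import all_boot all_order all_algebra.
From mathcomp Require Import generic_quotient ring_quotient ring.
From mathcomp Require Import boolp classical_sets topology.

Set Implicit Arguments.
Unset Strict Implicit.
Unset Printing Implicit Defensive.

Import GRing.Theory.
Local Open Scope classical_set_scope.
Local Open Scope ring_scope.
Local Open Scope quotient_scope.

Section Ideals.
Variable A : comPzRingType.

Definition is_ideal (I : set A) : Prop :=
  [/\ I 0, forall x y, I x -> I y -> I (x + y) & forall a x, I x -> I (a * x)].

Record ideal := Ideal { ideal_set :> A -> Prop; idealP : is_ideal ideal_set }.

Lemma smallest_is_ideal (S : set A) : is_ideal (smallest is_ideal S).
Proof.
split=> [I [[] //]|x y Sx Sy I SI|a x Sx I SI].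
  by have [[_ ID _] _] := SI; apply: ID; [apply: Sx|apply: Sy].
by have [[_ _ IM] _] := SI; apply: IM; apply: Sx.
Qed.

Definition ideal_gen (S : set A) : ideal := Ideal (smallest_is_ideal S).

Lemma is_ideal_setT : is_ideal [set: A]. Proof. by split. Qed.

Definition ideal_mul (I J : ideal) : ideal :=
  ideal_gen [set z | exists x y, [/\ I x, J y & z = x * y]].

Definition ideal_exp (I : ideal) (n : nat) : ideal :=
  iter n (ideal_mul I) (Ideal is_ideal_setT).

Definition radical (I : set A) : set A := [set x | exists n : nat, I (x ^+ n)].

Definition is_maximal (m : ideal) : Prop :=
  ~ m 1 /\ forall J : ideal, m `<=` J -> ~ J 1 -> J `<=` m.

Definition is_local : Prop :=
  exists2 m : ideal, is_maximal m &
    forall m' : ideal, is_maximal m' -> m' = m :> set A.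

Definition noetherian : Prop :=
  forall I : ideal, exists s : seq A, I = ideal_gen [set` s] :> set A.

Definition ideal_pred (I : ideal) : A -> bool := fun x => `[< I x >].

Lemma ideal_pred_zmod_closed I : zmod_closed (ideal_pred I).
Proof.
have [I0 ID IM] := idealP I; split; first exact/asboolP.
move=> x y /asboolP Ix /asboolP Iy; apply/asboolP; apply: ID => //.
by rewrite -mulN1r; apply: IM.
Qed.

HB.instance Definition _ I :=
  GRing.isZmodClosed.Build A (ideal_pred I) (ideal_pred_zmod_closed I).

Definition ideal_zmod (I : ideal) : zmodClosed A :=
  GRing.ZmodClosed.clone A (ideal_pred I) _.

Lemma ideal_mul_in (I J : ideal) x y : I x -> J y -> ideal_mul I J (x * y).
Proof. by move=> Ix Jy K [_]; apply; exists x, y. Qed.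

End Ideals.
Arguments noetherian A : clear implicits.
Arguments is_local A : clear implicits.

(* [ring_quotient] only provides the ring structure for a proper ideal of a
   nontrivial ring; here it is put on the additive quotient by any ideal. *)
Section QuotientRing.
Variables (A : comPzRingType) (I : ideal A).

Definition quot_ring : Type := Quotient.quot (ideal_zmod I).
HB.instance Definition _ := GRing.Zmodule.on quot_ring.

Definition quot (x : A) : quot_ring := \pi_(Quotient.quot (ideal_zmod I)) x.

Lemma quotB : zmod_morphism quot.
Proof. by move=> x y; rewrite /quot raddfB. Qed.

HB.instance Definition _ := GRing.isZmodMorphism.Build A quot_ring quot quotB.

Lemma quot_eq x y : quot x = quot y <-> I (x - y).
Proof.
rewrite /quot; split=> [/eqP|Ixy]; first by rewrite -Quotient.idealrBE => /asboolP.
by apply/eqP; rewrite -Quotient.idealrBE; apply/asboolP.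
Qed.

Definition quot_repr (a : quot_ring) : A := repr (a : Quotient.quot (ideal_zmod I)).

Lemma quotK : cancel quot_repr quot.
Proof. by move=> a; rewrite /quot /quot_repr reprK. Qed.

Definition quot_mul (a b : quot_ring) : quot_ring :=
  quot (quot_repr a * quot_repr b).

Lemma quotM x y : quot (x * y) = quot_mul (quot x) (quot y).
Proof.
have [_ ID IM] := idealP I; apply/quot_eq.
set x' := quot_repr _; set y' := quot_repr _.
have Ix : I (x - x') by apply/quot_eq; rewrite quotK.
have Iy : I (y - y') by apply/quot_eq; rewrite quotK.
have -> : x * y - x' * y' = y * (x - x') + x' * (y - y') by ring.
by apply: ID; apply: IM.
Qed.

Lemma quot_mulA : associative quot_mul.
Proof. by move=> a b c; rewrite -[a]quotK -[b]quotK -[c]quotK -!quotM mulrA. Qed.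

Lemma quot_mulC : commutative quot_mul.
Proof. by move=> a b; rewrite -[a]quotK -[b]quotK -!quotM mulrC. Qed.

Lemma quot_mul1 : left_id (quot 1) quot_mul.
Proof. by move=> a; rewrite -[a]quotK -!quotM mul1r. Qed.

Lemma quot_mulDl : left_distributive quot_mul +%R.
Proof.
move=> a b c; rewrite -[a]quotK -[b]quotK -[c]quotK.
by rewrite -raddfD -!quotM mulrDl raddfD.
Qed.

HB.instance Definition _ := GRing.Zmodule_isComPzRing.Build quot_ring
  quot_mulA quot_mulC quot_mul1 quot_mulDl.

Lemma quot_monoid_morphism : monoid_morphism quot.
Proof. by split=> // x y; rewrite quotM. Qed.

HB.instance Definition _ :=
  GRing.isMonoidMorphism.Build A quot_ring quot quot_monoid_morphism.

End QuotientRing.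

Section Localization.
Variable A : comPzRingType.

Record mulset := MulSet {
  mul_set :> A -> Prop;
  mulset1 : mul_set 1;
  mulsetM : forall x y, mul_set x -> mul_set y -> mul_set (x * y) }.

Variable S : mulset.

Record fraction := Fraction { frac_pair : A * A; _ : `[< S frac_pair.2 >] }.
HB.instance Definition _ := [isSub for frac_pair].
HB.instance Definition _ := [Choice of fraction by <:].

Definition fnum (x : fraction) := (frac_pair x).1.
Definition fden (x : fraction) := (frac_pair x).2.

Lemma fdenP x : S (fden x).
Proof. by case: x => x Hx; exact: (asboolW Hx). Qed.

Definition frac (a s : A) (Ss : S s) : fraction := @Fraction (a, s) (asboolT Ss).

Definition frac_eq (x y : fraction) : bool :=
  `[< exists2 u, S u & u * (fnum x * fden y) = u * (fnum y * fden x) >].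

Lemma frac_eq_refl : reflexive frac_eq.
Proof. by move=> x; apply/asboolP; exists 1 => //; exact: mulset1. Qed.

Lemma frac_eq_sym : symmetric frac_eq.
Proof. by move=> x y; apply/asboolP/asboolP => -[u Su e]; exists u. Qed.

Lemma frac_eq_trans : transitive frac_eq.
Proof.
move=> y x z /asboolP[u Su exy] /asboolP[v Sv eyz]; apply/asboolP.
exists (u * v * fden y); first by do !apply: mulsetM => //; exact: fdenP.
ring: exy eyz.
Qed.

Canonical frac_equiv := EquivRel frac_eq frac_eq_refl frac_eq_sym frac_eq_trans.

Definition loc : Type := {eq_quot frac_eq}.
HB.instance Definition _ := Choice.on loc.

Definition loc_pi (x : fraction) : loc := \pi_({eq_quot frac_eq}) x.
Definition loc_repr (a : loc) : fraction := repr (a : {eq_quot frac_eq}).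

Lemma loc_reprK : cancel loc_repr loc_pi.
Proof. by move=> a; rewrite /loc_repr /loc_pi reprK. Qed.

Lemma loc_eq x y : loc_pi x = loc_pi y <->
  exists2 u, S u & u * (fnum x * fden y) = u * (fnum y * fden x).
Proof.
rewrite /loc_pi; split=> [/eqmodP /asboolP //|h].
by apply/eqmodP/asboolP.
Qed.

Definition frac_add x y : fraction :=
  frac (fnum x * fden y + fnum y * fden x) (mulsetM (fdenP x) (fdenP y)).
Definition frac_opp x : fraction := frac (- fnum x) (fdenP x).
Definition frac_mul x y : fraction :=
  frac (fnum x * fnum y) (mulsetM (fdenP x) (fdenP y)).
Definition frac_of (a : A) : fraction := frac a (mulset1 S).

Definition loc_add a b := loc_pi (frac_add (loc_repr a) (loc_repr b)).
Definition loc_opp a := loc_pi (frac_opp (loc_repr a)).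
Definition loc_mul a b := loc_pi (frac_mul (loc_repr a) (loc_repr b)).
Definition in_loc (a : A) : loc := loc_pi (frac_of a).

Lemma loc_piD x y : loc_pi (frac_add x y) = loc_add (loc_pi x) (loc_pi y).
Proof.
apply/loc_eq; set x' := loc_repr _; set y' := loc_repr _.
have /loc_eq [u Su eu] : loc_pi x = loc_pi x' by rewrite loc_reprK.
have /loc_eq [v Sv ev] : loc_pi y = loc_pi y' by rewrite loc_reprK.
exists (u * v); first exact: mulsetM.
rewrite /frac_add /fnum /fden /= in eu ev *; ring: eu ev.
Qed.

Lemma loc_piN x : loc_pi (frac_opp x) = loc_opp (loc_pi x).
Proof.
apply/loc_eq; set x' := loc_repr _.
have /loc_eq [u Su eu] : loc_pi x = loc_pi x' by rewrite loc_reprK.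
exists u => //; rewrite /frac_opp /fnum /fden /= in eu *; ring: eu.
Qed.

Lemma loc_piM x y : loc_pi (frac_mul x y) = loc_mul (loc_pi x) (loc_pi y).
Proof.
apply/loc_eq; set x' := loc_repr _; set y' := loc_repr _.
have /loc_eq [u Su eu] : loc_pi x = loc_pi x' by rewrite loc_reprK.
have /loc_eq [v Sv ev] : loc_pi y = loc_pi y' by rewrite loc_reprK.
exists (u * v); first exact: mulsetM.
rewrite /frac_mul /fnum /fden /= in eu ev *; ring: eu ev.
Qed.

Lemma loc_addA : associative loc_add.
Proof.
move=> a b c; rewrite -[a]loc_reprK -[b]loc_reprK -[c]loc_reprK -!loc_piD.
apply/loc_eq; exists 1; first exact: mulset1.
by rewrite /frac_add /fnum /fden /=; ring.
Qed.

Lemma loc_addC : commutative loc_add.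
Proof.
move=> a b; rewrite -[a]loc_reprK -[b]loc_reprK -!loc_piD.
apply/loc_eq; exists 1; first exact: mulset1.
by rewrite /frac_add /fnum /fden /=; ring.
Qed.

Lemma loc_add0 : left_id (in_loc 0) loc_add.
Proof.
move=> a; rewrite -[a]loc_reprK -!loc_piD.
apply/loc_eq; exists 1; first exact: mulset1.
by rewrite /frac_add /fnum /fden /=; ring.
Qed.

Lemma loc_addN : left_inverse (in_loc 0) loc_opp loc_add.
Proof.
move=> a; rewrite -[a]loc_reprK -loc_piN -loc_piD.
apply/loc_eq; exists 1; first exact: mulset1.
by rewrite /frac_add /frac_opp /fnum /fden /=; ring.
Qed.

HB.instance Definition _ :=
  GRing.isZmodule.Build loc loc_addA loc_addC loc_add0 loc_addN.

Lemma loc_mulA : associative loc_mul.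
Proof.
move=> a b c; rewrite -[a]loc_reprK -[b]loc_reprK -[c]loc_reprK -!loc_piM.
apply/loc_eq; exists 1; first exact: mulset1.
by rewrite /frac_mul /fnum /fden /=; ring.
Qed.

Lemma loc_mulC : commutative loc_mul.
Proof.
move=> a b; rewrite -[a]loc_reprK -[b]loc_reprK -!loc_piM.
apply/loc_eq; exists 1; first exact: mulset1.
by rewrite /frac_mul /fnum /fden /=; ring.
Qed.

Lemma loc_mul1 : left_id (in_loc 1) loc_mul.
Proof.
move=> a; rewrite -[a]loc_reprK -!loc_piM.
apply/loc_eq; exists 1; first exact: mulset1.
by rewrite /frac_mul /fnum /fden /=; ring.
Qed.

Lemma loc_mulDl : left_distributive loc_mul loc_add.
Proof.
move=> a b c; rewrite -[a]loc_reprK -[b]loc_reprK -[c]loc_reprK.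
rewrite -loc_piD -!loc_piM -loc_piD.
apply/loc_eq; exists 1; first exact: mulset1.
by rewrite /frac_mul /frac_add /fnum /fden /=; ring.
Qed.

HB.instance Definition _ := GRing.Zmodule_isComPzRing.Build loc
  loc_mulA loc_mulC loc_mul1 loc_mulDl.

Lemma in_locB : zmod_morphism in_loc.
Proof.
move=> x y; transitivity (loc_add (in_loc x) (loc_opp (in_loc y))) => [|//].
rewrite /in_loc -loc_piN -loc_piD.
apply/loc_eq; exists 1; first exact: mulset1.
by rewrite /frac_add /frac_opp /fnum /fden /=; ring.
Qed.

HB.instance Definition _ := GRing.isZmodMorphism.Build A loc in_loc in_locB.

Lemma in_loc_monoid_morphism : monoid_morphism in_loc.
Proof.
split=> // x y; transitivity (loc_mul (in_loc x) (in_loc y)) => [|//].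
rewrite /in_loc -loc_piM.
apply/loc_eq; exists 1; first exact: mulset1.
by rewrite /frac_mul /fnum /fden /=; ring.
Qed.

HB.instance Definition _ :=
  GRing.isMonoidMorphism.Build A loc in_loc in_loc_monoid_morphism.

End Localization.

Section Spectrum.
Variable A : comPzRingType.

Record spec := Spec {
  spec_ideal :> ideal A;
  spec_proper : ~ spec_ideal 1;
  spec_prime : forall x y, spec_ideal (x * y) -> spec_ideal x \/ spec_ideal y }.

HB.instance Definition _ := gen_eqMixin spec.
HB.instance Definition _ := gen_choiceMixin spec.

Definition zeros (S : set A) : set spec := [set p | S `<=` p].

Definition zariski_open (U : set spec) : Prop :=
  exists S : set A, U = ~` zeros S.

Lemma zariski_openT : zariski_open setT.
Proof. by exists setT; apply/seteqP; split=> // p _ /(_ 1 I) /(spec_proper (s:=p)). Qed.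

Lemma zariski_openI : setI_closed zariski_open.
Proof.
move=> _ _ [S ->] [T ->].
exists [set z | exists x y, [/\ S x, T y & z = x * y]].
apply/seteqP; split=> p /=.
  move=> [/existsNP[x /not_implyP[Sx px]] /existsNP[y /not_implyP[Ty py]]] h.
  have /spec_prime [] // : p (x * y) by apply: h; exists x, y.
move=> h; split=> h'; apply: h => _ [x [y [Sx Ty ->]]].
  by rewrite mulrC; have [_ _] := idealP p; apply; apply: h'.
by have [_ _] := idealP p; apply; apply: h'.
Qed.

Lemma zariski_open_bigU (J : Type) (F : J -> set spec) :
  (forall i, zariski_open (F i)) -> zariski_open (\bigcup_i F i).
Proof.
move=> /choice[S FS]; exists (\bigcup_i S i); apply/seteqP; split=> p /=.
  by move=> [i _]; rewrite FS => nSp h; apply: nSp => x Sx; apply: h; exists i.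
apply: contra_notP => h x [i _ Six]; apply: contrapT => px; apply: h.
by exists i => //; rewrite FS => /(_ x Six).
Qed.

HB.instance Definition _ := isOpenTopological.Build spec
  zariski_openT zariski_openI zariski_open_bigU.

Lemma spec_compl1 (p : spec) : ~ p 1. Proof. exact: spec_proper. Qed.

Lemma spec_complM (p : spec) x y : ~ p x -> ~ p y -> ~ p (x * y).
Proof. by move=> px py /spec_prime[]. Qed.

Definition spec_compl (p : spec) : mulset A :=
  @MulSet A (fun x => ~ p x) (@spec_compl1 p) (@spec_complM p).

Definition prime_chain (p : spec) (n : nat) : Prop :=
  exists c : nat -> spec, c n = p /\ forall i, (i < n)%N -> c i `<` c i.+1.

(* Junk value 0 when the lengths of chains are unbounded, which does not happen
   in a Noetherian ring (Krull's height theorem). *)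
Definition ht (p : spec) : nat :=
  xget 0%N [set n | prime_chain p n /\ forall m, prime_chain p m -> (m <= n)%N].

End Spectrum.

Definition loc_at (A : comPzRingType) (p : spec A) : comPzRingType :=
  loc (spec_compl p).

Definition to_loc (A : comPzRingType) (p : spec A) : {rmorphism A -> loc_at p} :=
  @in_loc A (spec_compl p).

Definition extend (A B : comPzRingType) (f : A -> B) (I : ideal A) : ideal B :=
  ideal_gen (f @` I).

(* The quotient p^i / p^(i+1) as a module over A/p. *)
Section GradedPiece.
Variables (A : comPzRingType) (p : ideal A) (i : nat).

Record power_elt := PowerElt {
  power_val : A; _ : ideal_pred (ideal_exp p i) power_val }.
HB.instance Definition _ := [isSub for power_val].
HB.instance Definition _ := [Choice of power_elt by <:].
HB.instance Definition _ := [SubChoice_isSubZmodule of power_elt by <:].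

Lemma power_eltP (x : power_elt) : ideal_exp p i (val x).
Proof. by case: x => x Hx; exact: (asboolW Hx). Qed.

Definition next_power : power_elt -> bool :=
  fun x => ideal_pred (ideal_exp p i.+1) (val x).

Lemma next_power_zmod_closed : zmod_closed next_power.
Proof.
have [h0 hB] := ideal_pred_zmod_closed (ideal_exp p i.+1).
split=> [|x y hx hy]; rewrite unfold_in /next_power; first by rewrite raddf0.
by rewrite raddfB; apply: hB.
Qed.

HB.instance Definition _ :=
  GRing.isZmodClosed.Build power_elt next_power next_power_zmod_closed.

Definition next_zmod : zmodClosed power_elt :=
  GRing.ZmodClosed.clone power_elt next_power _.

Definition graded_piece : Type := Quotient.quot next_zmod.
HB.instance Definition _ := GRing.Zmodule.on graded_piece.

Definition gr (x : power_elt) : graded_piece := \pi_(Quotient.quot next_zmod) x.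
Definition gr_repr (m : graded_piece) : power_elt :=
  repr (m : Quotient.quot next_zmod).

Lemma grK : cancel gr_repr gr.
Proof. by move=> m; rewrite /gr /gr_repr reprK. Qed.

Lemma grD x y : gr (x + y) = gr x + gr y.
Proof. by rewrite /gr raddfD. Qed.

Lemma gr_eq x y : gr x = gr y <-> ideal_exp p i.+1 (val x - val y).
Proof.
rewrite /gr -raddfB; split=> [/eqP|h].
  by rewrite -Quotient.idealrBE => /asboolP.
by apply/eqP; rewrite -Quotient.idealrBE; apply/asboolP.
Qed.

Lemma power_scale_subproof (a : A) (x : power_elt) :
  ideal_pred (ideal_exp p i) (a * val x).
Proof.
by apply/asboolP; have [_ _] := idealP (ideal_exp p i); apply; apply: power_eltP.
Qed.

Definition power_scale a x : power_elt := PowerElt (power_scale_subproof a x).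

Definition gr_scale (a : quot_ring p) (m : graded_piece) : graded_piece :=
  gr (power_scale (quot_repr a) (gr_repr m)).

Lemma gr_scaleE a x : gr_scale (quot p a) (gr x) = gr (power_scale a x).
Proof.
apply/gr_eq => /=; set b := quot_repr _; set y := gr_repr _.
have pab : p (b - a) by apply/quot_eq; rewrite quotK.
have ixy : ideal_exp p i.+1 (val y - val x) by apply/gr_eq; rewrite grK.
have [_ ID IM] := idealP (ideal_exp p i.+1).
have -> : b * val y - a * val x = (b - a) * val y + a * (val y - val x) by ring.
by apply: ID; [apply: ideal_mul_in => //; apply: power_eltP|apply: IM].
Qed.

Lemma gr_scaleA a b m : gr_scale a (gr_scale b m) = gr_scale (a * b) m.
Proof.
rewrite -[m]grK -[a]quotK -[b]quotK gr_scaleE gr_scaleE -rmorphM gr_scaleE.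
by congr gr; apply: val_inj; rewrite /= mulrA.
Qed.

Lemma gr_scale1 : left_id 1 gr_scale.
Proof.
move=> m; rewrite -[m]grK -(rmorph1 (quot p)) gr_scaleE.
by congr gr; apply: val_inj; rewrite /= mul1r.
Qed.

Lemma gr_scaleDr : right_distributive gr_scale +%R.
Proof.
move=> a m n; rewrite -[m]grK -[n]grK -[a]quotK -grD !gr_scaleE -grD.
by congr gr; apply: val_inj; rewrite /= mulrDr.
Qed.

Lemma gr_scaleDl m : {morph gr_scale^~ m : a b / a + b}.
Proof.
move=> a b; rewrite -[m]grK -[a]quotK -[b]quotK -raddfD !gr_scaleE -grD.
by congr gr; apply: val_inj; rewrite /= mulrDl.
Qed.

HB.instance Definition _ := GRing.Zmodule_isLmodule.Build (quot_ring p)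
  graded_piece gr_scaleA gr_scale1 gr_scaleDr gr_scaleDl.

End GradedPiece.

Definition free_of_finite_rank (R : pzRingType) (M : lmodType R) : Prop :=
  exists (n : nat) (f : {linear 'rV[R]_n -> M}), bijective f.

Definition regular_seq (R : comPzRingType) (s : seq R) : Prop :=
  (forall i, (i < size s)%N ->
     forall y : quot_ring (ideal_gen [set` take i s]),
       quot _ s`_i * y = 0 -> y = 0)
  /\ ideal_gen [set` s] <> setT :> set R.

Definition ring_iso (R S : comPzRingType) : Prop :=
  exists f : {rmorphism R -> S}, bijective f.

(* A property of Noetherian local rings is a predicate on rings of which only the
   values at Noetherian local rings matter. *)
Definition iso_invariant (P : comPzRingType -> Prop) : Prop :=
  forall R S : comPzRingType, noetherian R -> is_local R ->
    noetherian S -> is_local S -> ring_iso R S -> P R -> P S.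

Section Criteria.
Variable P : comPzRingType -> Prop.

Definition locus (A : comPzRingType) : set (spec A) := [set p | P (loc_at p)].
Arguments locus : clear implicits.

Definition Q0 (A : comPzRingType) : Prop :=
  forall p : spec A, exists U : set (spec (quot_ring p)),
    [/\ open U, U !=set0 & U `<=` locus (quot_ring p)].

Definition NC : Prop :=
  forall A : comPzRingType, noetherian A -> Q0 A -> open (locus A).

Definition A1 : Prop :=
  forall A : comPzRingType, noetherian A -> forall q p : spec A,
    q `<=` p -> P (loc_at p) -> P (loc_at q).

Definition A2 : Prop :=
  forall A : comPzRingType, noetherian A -> forall p : spec A, locus A p ->
  exists x : (ht p).-tuple A,
    (forall i, p (tnth x i)) /\
    let I := ideal_gen [set` x] in
    [/\ regular_seq (map (to_loc p) x)
          /\ radical (extend (to_loc p) I) = extend (to_loc p) p,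
        exists2 P' : spec (quot_ring I), P' = quot I @` p :> set _ &
          locus (quot_ring I) P'
      & exists W : set (spec A), [/\ open W, W p &
          forall q : spec A, W q -> zeros p q ->
            P (quot_ring (extend (to_loc q) I)) -> P (loc_at q)]].

Definition A3 : Prop :=
  forall A : comPzRingType, noetherian A -> Q0 A ->
  forall p : spec A, locus A p ->
  forall r : nat, (1 <= r)%N -> ideal_exp p r = [set 0] :> set A ->
  (forall i, (i < r)%N -> free_of_finite_rank (graded_piece p i)) ->
  exists U : set (spec A), [/\ open U, U p &
    forall q : spec A, U q ->
      P (quot_ring (extend (to_loc q) p)) -> P (loc_at q)].

End Criteria.

(* Main.v *)
Require Import Defs.
From HB Require Import structures.
From mathcomp Require Import all_boot all_order all_algebra.
From mathcomp Require Import ring.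
From mathcomp Require Import boolp classical_sets topology.

Set Implicit Arguments.
Unset Strict Implicit.
Unset Printing Implicit Defensive.

Import GRing.Theory.
Local Open Scope classical_set_scope.
Local Open Scope ring_scope.

(* (1) is immediate, since NC makes the whole locus open.  For (2), by (A-1) and
   Nagata's topological criterion it is enough that a prime p in the locus has a
   neighbourhood D(b) with D(b) and V(p) meeting inside the locus.  (A-2) replaces
   A by A/I, where p becomes nilpotent after localizing at p; inverting one further
   element f makes p^r = 0 and all p^i/p^(i+1) free (generic freeness), and then
   (A-3) together with Q0 for A/p gives the neighbourhood.  All the rings met on
   the way, such as A_q/IA_q, (A/I)_q or ((A/I)_f)_q, are localizations of
   quotients of A; they are recognized by an elementwise characterization that is
   stable under composition and determines the ring up to isomorphism. *)

(** * Ideals: adjoining an element, colon ideals and powers *)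

Section IdealTheory.
Variable A : comPzRingType.
Implicit Types (I J K : ideal A) (a x y : A).

Lemma ideal0 I : I 0. Proof. by have [] := idealP I. Qed.

Lemma idealD I x y : I x -> I y -> I (x + y).
Proof. by have [_ h _] := idealP I; exact: h. Qed.

Lemma idealMl I a x : I x -> I (a * x).
Proof. by have [_ _ h] := idealP I; exact: h. Qed.

Lemma idealMr I a x : I x -> I (x * a).
Proof. by rewrite mulrC; exact: idealMl. Qed.

Lemma idealN I x : I x -> I (- x).
Proof. by rewrite -mulN1r; exact: idealMl. Qed.

Lemma idealB I x y : I x -> I y -> I (x - y).
Proof. by move=> Ix /idealN; exact: idealD. Qed.

Lemma ideal_gen_sub (E : set A) : E `<=` ideal_gen E.
Proof. by move=> x Ex I [_]; apply. Qed.

Lemma ideal_gen_min (E : set A) I : E `<=` I -> ideal_gen E `<=` I.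
Proof. by move=> EI x; apply; split=> //; exact: idealP. Qed.

Lemma is_ideal_set0 : is_ideal [set 0 : A].
Proof. by split=> [//|_ _ -> ->|a _ ->]; rewrite /= ?addr0 ?mulr0. Qed.

Definition zero_ideal : ideal A := Ideal is_ideal_set0.

Lemma adjoin_is_ideal I a : is_ideal [set x | exists2 c, I c & exists d, x = c + d * a].
Proof.
split=> [|x y [c Ic [d ->]] [c' Ic' [d' ->]]|b x [c Ic [d ->]]] /=.
- by exists 0; [exact: ideal0|exists 0; ring].
- by exists (c + c'); [exact: idealD|exists (d + d'); ring].
- by exists (b * c); [exact: idealMl|exists (b * d); ring].
Qed.

Definition adjoin I a : ideal A := Ideal (adjoin_is_ideal I a).

Lemma sub_adjoin I a : I `<=` adjoin I a.
Proof. by move=> c Ic; exists c => //; exists 0; ring. Qed.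

Lemma adjoin_mem I a : adjoin I a a.
Proof. by exists 0; [exact: ideal0|exists 1; ring]. Qed.

Lemma adjoin_min I J a : I `<=` J -> J a -> adjoin I a `<=` J.
Proof. by move=> IJ Ja _ [c /IJ Jc [d ->]]; apply: idealD => //; exact: idealMl. Qed.

Lemma ideal_gen_nil x : ideal_gen [set` [::]] x -> x = 0.
Proof. by apply: (@ideal_gen_min _ zero_ideal). Qed.

Lemma ideal_gen_cons a (s : seq A) :
  ideal_gen [set` a :: s] `<=` adjoin (ideal_gen [set` s]) a.
Proof.
apply: ideal_gen_min => x xs.
have /[!inE] /orP[/eqP->|sx] : x \in a :: s by [].
  exact: adjoin_mem.
by apply: sub_adjoin; exact: ideal_gen_sub.
Qed.

Lemma ideal_mul_min I J K :
  (forall x y, I x -> J y -> K (x * y)) -> ideal_mul I J `<=` K.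
Proof. by move=> h; apply: ideal_gen_min => _ [x [y [Ix Jy ->]]]; exact: h. Qed.

Lemma ideal_mulS I I' J J' :
  I `<=` I' -> J `<=` J' -> ideal_mul I J `<=` ideal_mul I' J'.
Proof.
by move=> II' JJ'; apply: ideal_mul_min => x y /II' ? /JJ' ?; exact: ideal_mul_in.
Qed.

Lemma ideal_expSn I n : ideal_exp I n.+1 = ideal_mul I (ideal_exp I n).
Proof. by []. Qed.

Lemma ideal_expS I J n : I `<=` J -> ideal_exp I n `<=` ideal_exp J n.
Proof. by move=> IJ; elim: n => // n IH; rewrite !ideal_expSn; exact: ideal_mulS. Qed.

Lemma colon_is_ideal I a : is_ideal [set x | I (a * x)].
Proof.
split=> [|x y|b x] /=; first by rewrite mulr0; exact: ideal0.
  by rewrite mulrDr; exact: idealD.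
by rewrite mulrCA; exact: idealMl.
Qed.

Definition colon I a : ideal A := Ideal (colon_is_ideal I a).

(** The conclusion on [z] is membership in the colon ideal [(K : a)], so it can be checked on
    products. *)
Lemma ideal_mul_scale_min I J K a :
  (forall x y, I x -> J y -> K (a * (x * y))) ->
  forall z, ideal_mul I J z -> K (a * z).
Proof. by move=> h; apply: (@ideal_mul_min _ _ (colon K a)). Qed.

Lemma ideal_expD I m n :
  ideal_exp I (m + n) `<=` ideal_mul (ideal_exp I m) (ideal_exp I n).
Proof.
elim: m => [|m IH]; first by move=> x Ix; rewrite -[x]mul1r; apply: ideal_mul_in.
rewrite addSn !ideal_expSn; apply: ideal_mul_min => x y Ix /IH.
apply: ideal_mul_scale_min => u v mu nv.
by rewrite mulrA; apply: ideal_mul_in => //; apply: ideal_mul_in.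
Qed.

Lemma ideal_expM I m n : ideal_exp I (n * m) `<=` ideal_exp (ideal_exp I m) n.
Proof.
elim: n => [|n IH] //; rewrite mulSn ideal_expSn => x /ideal_expD.
by apply: ideal_mulS.
Qed.

Lemma ideal_exp_scale I J a n : (forall x, I x -> J (a * x)) ->
  forall x, ideal_exp I n x -> ideal_exp J n (a ^+ n * x).
Proof.
move=> h; elim: n => [//|n IH]; rewrite !ideal_expSn.
apply: ideal_mul_scale_min => x y Ix ny.
have -> : a ^+ n.+1 * (x * y) = (a * x) * (a ^+ n * y) by rewrite exprS; ring.
by apply: ideal_mul_in; [exact: h|exact: IH].
Qed.

(** When a product of [n] elements [c + d * a] is expanded, every term but the multiple of [a ^+ n]
    has a factor in [I]. *)
Lemma adjoin_exp I a n : ideal_exp (adjoin I a) n `<=` adjoin I (a ^+ n).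
Proof.
elim: n => [|n IH].
  by move=> x _; exists 0; [exact: ideal0|exists x; rewrite expr0; ring].
rewrite ideal_expSn; apply: ideal_mul_min => _ y [c Ic [d ->]] /IH [c' Ic' [d' ->]].
exists (c * (c' + d' * a ^+ n) + d * a * c').
  by apply: idealD; [exact: idealMr|exact: idealMl].
by exists (d * d'); rewrite exprS; ring.
Qed.

Lemma ideal_expS_sub I n : ideal_exp I n.+1 `<=` ideal_exp I n.
Proof. by apply: ideal_mul_min => x y _ ny; exact: idealMl. Qed.

End IdealTheory.

Lemma preim_is_ideal (A B : comPzRingType) (f : {rmorphism A -> B}) (J : ideal B) :
  is_ideal (f @^-1` J).
Proof.
split=> [|x y|a x] /=; first by rewrite rmorph0; exact: ideal0.
  by rewrite rmorphD; exact: idealD.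
by rewrite rmorphM; exact: idealMl.
Qed.

Definition preim_ideal (A B : comPzRingType) (f : {rmorphism A -> B}) (J : ideal B) :=
  Ideal (preim_is_ideal f J).

(** * Noetherian induction on ideals *)

Section NoetherianInduction.
Variable A : comPzRingType.
Hypothesis noethA : noetherian A.

(** Every counterexample lies strictly inside another one, so choice yields a strictly ascending
    chain; its union is finitely generated, which forces the chain to stop. *)
Lemma noetherian_ind (Q : ideal A -> Prop) :
  (forall I : ideal A, (forall J : ideal A, I `<=` J -> ~ J `<=` I -> Q J) -> Q I) ->
  forall I : ideal A, Q I.
Proof.
move=> step I0; apply: contrapT => nQ0.
have /choice[next nextP] : forall I : {I : ideal A | ~ Q I}, exists J : {I : ideal A | ~ Q I},
    sval I `<=` sval J /\ ~ sval J `<=` sval I.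
  move=> [I nQI] /=; apply: contrapT => h; apply: nQI; apply: step => J IJ nJI.
  by apply: contrapT => nQJ; apply: h; exists (exist _ J nQJ).
pose c n := sval (iter n next (exist _ I0 nQ0)).
have c_mono m n : (m <= n)%N -> c m `<=` c n.
  elim: n => [|n IH]; first by rewrite leqn0 => /eqP ->.
  rewrite leq_eqVlt => /orP[/eqP -> //|/IH h x /h].
  by apply: (nextP _).1.
have cU : is_ideal [set x | exists n, c n x].
  split=> [|x y [m cx] [n cy]|a x [n cx]] /=.
  - by exists 0%N; exact: ideal0.
  - exists (maxn m n); apply: idealD.
      by apply: c_mono cx; rewrite leq_maxl.
    by apply: c_mono cy; rewrite leq_maxr.
  - by exists n; exact: idealMl.
have [s sP] := noethA (Ideal cU).
have [N sN] : exists N, {in s, forall x, c N x}.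
  have : {in s, forall x, exists n, c n x}.
    move=> x sx; have : ideal_gen [set` s] x by apply: ideal_gen_sub.
    by rewrite -sP.
  elim: s {sP} => [|x s IH] h; first by exists 0%N.
  have [|N cN] := IH; first by move=> y sy; apply: h; rewrite inE sy orbT.
  have [|n cx] := h x; first by rewrite inE eqxx.
  exists (maxn n N) => y; rewrite inE => /orP[/eqP ->|/cN].
    by apply: c_mono cx; rewrite leq_maxl.
  by apply: c_mono; rewrite leq_maxr.
have [_] := nextP (iter N next (exist _ I0 nQ0)); apply=> x cx.
have : ideal_gen [set` s] x by rewrite -sP; exists N.+1.
by apply: (@ideal_gen_min _ _ (c N)) => y /sN.
Qed.

End NoetherianInduction.

(** * Localizations of quotients, characterized by elements *)

Section QuotLoc.

(* [R] is the localization of [A / I] at the image of [S], with [f] as the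
   canonical map. *)
Definition quot_loc (A R : comPzRingType) (f : {rmorphism A -> R}) (S I : set A) :=
  [/\ forall s, S s -> exists t, t * f s = 1,
      forall x, exists2 s, S s & exists a, x * f s = f a
    & forall a, f a = 0 <-> exists2 s, S s & I (s * a)].

Lemma mulset1M (A : comPzRingType) (x y : A) : x = 1 -> y = 1 -> x * y = 1.
Proof. by move=> -> ->; rewrite mulr1. Qed.

Definition trivial_mulset (A : comPzRingType) : mulset A :=
  @MulSet A (fun x => x = 1) erefl (@mulset1M A).

Lemma quot_loc_quot (A : comPzRingType) (I : ideal A) :
  quot_loc (quot I : {rmorphism A -> quot_ring I}) (trivial_mulset A) I.
Proof.
split=> [_ ->|x|a].
- by exists 1; rewrite rmorph1 mulr1.
- by exists 1 => //; exists (quot_repr x); rewrite rmorph1 mulr1; exact/esym/quotK.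
- apply: (iff_trans (B := I a)).
    by rewrite -{2}[a]subr0 -quot_eq (rmorph0 (quot I)).
  by split=> [Ia|[_ ->]]; [exists 1|]; rewrite ?mul1r.
Qed.

Lemma quot_loc_loc (A : comPzRingType) (S : mulset A) :
  quot_loc (in_loc S : {rmorphism A -> loc S}) S [set 0].
Proof.
split=> [s Ss|x|a].
- exists (loc_pi (Defs.frac 1 Ss)).
  transitivity (loc_mul (loc_pi (Defs.frac 1 Ss)) (in_loc S s)) => //.
  rewrite -loc_piM; apply/loc_eq; exists 1; first exact: mulset1.
  by rewrite /frac_mul /frac_of /fnum /fden /=; ring.
- rewrite -[x]loc_reprK; set y := loc_repr x.
  exists (fden y); first exact: fdenP.
  exists (fnum y); transitivity (loc_mul (loc_pi y) (in_loc S (fden y))) => //.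
  rewrite -loc_piM; apply/loc_eq; exists 1; first exact: mulset1.
  by rewrite /frac_mul /frac_of /fnum /fden /=; ring.
- rewrite -(rmorph0 (in_loc S)); apply: (iff_trans (loc_eq _ _)).
  rewrite /frac_of /fnum /fden /=; split=> [[u Su e]|[u Su e]]; exists u => //.
    by rewrite /= -[a]mulr1 e; ring.
  by rewrite mulr1 e; ring.
Qed.

Section Theory.
Variables (A R : comPzRingType) (f : {rmorphism A -> R}) (S : mulset A) (I : ideal A).
Hypothesis fP : quot_loc f S I.

Lemma quot_loc_unit s : S s -> exists t, t * f s = 1.
Proof. by case: fP => h _ _; apply: h. Qed.

Lemma quot_loc_repr x : exists2 s, S s & exists a, x * f s = f a.
Proof. by case: fP. Qed.

Lemma quot_loc_ker a : f a = 0 <-> exists2 s, S s & I (s * a).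
Proof. by case: fP. Qed.

Lemma quot_loc_inj s x y : S s -> x * f s = y * f s -> x = y.
Proof.
move=> /quot_loc_unit[t ts] e.
by rewrite -[x]mulr1 -[y]mulr1 -ts mulrC [y * _]mulrC -!mulrA ![f s * _]mulrC e.
Qed.

Lemma quot_loc_eq a b : f a = f b <-> exists2 s, S s & I (s * (a - b)).
Proof.
rewrite -quot_loc_ker rmorphB; split=> [->|/eqP]; first by rewrite subrr.
by rewrite subr_eq0 => /eqP.
Qed.

Lemma quot_loc_common n (v : 'I_n -> R) :
  exists2 s, S s & exists c, forall j, v j * f s = f (c j).
Proof.
have /choice[s sP] j : exists s, S s /\ exists a, v j * f s = f a.
  by have [s Ss h] := quot_loc_repr (v j); exists s.
have /choice[c cP] j : exists a, v j * f (s j) = f a by exact: (sP j).2.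
exists (\prod_j s j).
  by apply: (big_ind S); [exact: mulset1|exact: mulsetM|move=> j _; exact: (sP j).1].
(* Each numerator is multiplied by the denominators of the other entries. *)
exists (fun j => c j * \prod_(k | k != j) s k) => j.
by rewrite (bigD1 j) //= !rmorphM /= mulrA cP.
Qed.

(** The fractions with numerator in [K] already form an ideal, since two of them can be brought to a
    common denominator. *)
Lemma quot_loc_extend (K : ideal A) x :
  extend f K x <-> exists2 s, S s & exists2 a, K a & x * f s = f a.
Proof.
split.
- have E : is_ideal [set x | exists2 s, S s & exists2 a, K a & x * f s = f a].
    split=> [|y z [s Ss [a Ka e]] [t St [b Kb e']]|y z [s Ss [a Ka e]]] /=.
    + exists 1; first exact: mulset1.
      by exists 0; [exact: ideal0|rewrite mul0r rmorph0].
    + exists (s * t); first exact: mulsetM.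
      exists (a * t + b * s); first by apply: idealD; apply: idealMr.
      by rewrite rmorphD !rmorphM /= -e -e'; ring.
    + have [t St [b e']] := quot_loc_repr y.
      exists (s * t); first exact: mulsetM.
      exists (b * a); first exact: idealMl.
      by rewrite !rmorphM /= -e -e'; ring.
  apply: (@ideal_gen_min _ _ (Ideal E)) => _ [a Ka <-] /=.
  by exists 1; [exact: mulset1|exists a => //; rewrite rmorph1 mulr1].
- move=> [s Ss [a Ka e]]; have [t ts] := quot_loc_unit Ss.
  rewrite -[x]mulr1 -ts mulrCA e; apply: idealMl.
  by apply: ideal_gen_sub; exists a.
Qed.

Lemma quot_loc_extend_image (K : ideal A) a : K a -> extend f K (f a).
Proof. by move=> Ka; apply: ideal_gen_sub; exists a. Qed.

(** Equality of images in [R] is congruence modulo [I] up to a factor from [S]; as [I] lies in [K],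
    membership in [K] survives the change of numerator. *)
Lemma quot_loc_contract (K : ideal A) a : I `<=` K ->
  extend f K (f a) <-> exists2 s, S s & K (s * a).
Proof.
move=> IK; rewrite quot_loc_extend; split=> [[s Ss [b Kb]]|[s Ss Ka]].
  rewrite -rmorphM => /quot_loc_eq [t St /IK e]; exists (t * s).
    exact: mulsetM.
  have -> : t * s * a = t * (a * s - b) + t * b by ring.
  by apply: idealD => //; exact: idealMl.
by exists s => //; exists (s * a) => //; rewrite -rmorphM mulrC.
Qed.

(** Denominators are units, so an ideal of [R] is generated by the image of its contraction to
    [A]. *)
Lemma quot_loc_noetherian : noetherian A -> noetherian R.
Proof.
move=> noethA J.
have [s sP] := noethA (preim_ideal f J); exists (map f s).
apply/seteqP; split=> [x Jx|].
  have [u Su [a e]] := quot_loc_repr x; have [t tu] := quot_loc_unit Su.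
  have : preim_ideal f J a by rewrite /= -e; exact: idealMr.
  rewrite -[x]mulr1 -tu mulrCA e sP => sa.
  apply: idealMl.
  apply: (@ideal_gen_min _ _ (preim_ideal f (ideal_gen [set` map f s]))) sa => y sy.
  by apply: ideal_gen_sub; exact: map_f.
apply: ideal_gen_min => _ /mapP[y sy ->].
have : ideal_gen [set` s] y by apply: ideal_gen_sub.
by rewrite -sP.
Qed.

End Theory.
End QuotLoc.

(** Denominators for [f] map into [T], so numerators and denominators in [B] can both be cleared to
    elements of [A]. *)
Lemma quot_loc_comp (A B C : comPzRingType) (f : {rmorphism A -> B})
    (g : {rmorphism B -> C}) (S : set A) (T : mulset B) (I : set A) (J : ideal B) :
    (forall s, S s -> T (f s)) -> quot_loc f S I -> quot_loc g T J ->
  quot_loc (g \o f) (f @^-1` T) (f @^-1` J).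
Proof.
move=> ST [fu fr fk] gP; split=> [s Ts|x|a] /=.
- exact: quot_loc_unit gP _ Ts.
- have [b Tb [b' e]] := quot_loc_repr gP x.
  have [s Ss [a ea]] := fr b; have [s' Ss' [a' ea']] := fr b'.
  (* With [b = a / s] and [b' = a' / s'], the fraction [b' / b] becomes [(a' * s) / (a * s')]. *)
  exists (a * s').
    by rewrite /= rmorphM -ea; do !apply: mulsetM => //; exact: ST.
  by exists (a' * s); rewrite !rmorphM -ea -ea' !rmorphM /= -e; ring.
- rewrite (quot_loc_ker gP); split=> [[t Tt Jt]|[s Ts Js]]; last first.
    by exists (f s) => //; rewrite -rmorphM.
  have [s Ss [c e]] := fr t.
  exists c => /=; first by rewrite -e; apply: mulsetM => //; exact: ST.
  by rewrite /= rmorphM -e mulrAC; exact: idealMr.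
Qed.

Lemma quot_loc_mod (A R : comPzRingType) (f : {rmorphism A -> R}) (S : mulset A)
    (K I : ideal A) : K `<=` I -> quot_loc f S K ->
  quot_loc (quot (extend f I) \o f : {rmorphism A -> quot_ring (extend f I)}) S I.
Proof.
move=> KI fP; split=> [s Ss|x|a] /=.
- have [t ts] := quot_loc_unit fP Ss.
  by exists (quot _ t); rewrite -rmorphM ts rmorph1.
- have [s Ss [a e]] := quot_loc_repr fP (quot_repr x).
  by exists s => //; exists a; rewrite -e rmorphM; congr (_ * _); exact/esym/quotK.
- rewrite -(quot_loc_contract fP _ KI) -{2}[f a]subr0.
  by rewrite -quot_eq (rmorph0 (quot _)).
Qed.

(** Whether two fractions agree depends only on [S] and [I], so matching equal fractions is well
    defined in both directions. *)
Lemma quot_loc_iso (A R R' : comPzRingType) (f : {rmorphism A -> R})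
    (f' : {rmorphism A -> R'}) (S : mulset A) (I : ideal A) :
  quot_loc f S I -> quot_loc f' S I -> ring_iso R R'.
Proof.
move=> fP fP'.
(* The graph of the isomorphism: [x] and [y] are given by a common fraction [a / s]. *)
pose corr x y := exists2 s, S s & exists a, x * f s = f a /\ y * f' s = f' a.
(* Single-valuedness is stated for arbitrary models because it also gives, with the roles exchanged,
   that [psi] inverts [phi]. *)
have corr_fun (U V : comPzRingType) (g : {rmorphism A -> U}) (h : {rmorphism A -> V})
    x y y' : quot_loc g S I -> quot_loc h S I ->
    (exists2 s, S s & exists a, x * g s = g a /\ y * h s = h a) ->
    (exists2 s, S s & exists a, x * g s = g a /\ y' * h s = h a) -> y = y'.
  move=> gP hP [s Ss [a [ea ea']]] [t St [b [eb eb']]].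
  have : g (a * t) = g (b * s) by rewrite !rmorphM -ea -eb; ring.
  rewrite (quot_loc_eq gP) -(quot_loc_eq hP) !rmorphM -ea' -eb' => e.
  apply: (quot_loc_inj hP (mulsetM Ss St)).
  by rewrite rmorphM; ring: e.
have /choice[phi phiP] x : exists y, corr x y.
  have [s Ss [a e]] := quot_loc_repr fP x; have [t ts] := quot_loc_unit fP' Ss.
  exists (f' a * t); exists s => //; exists a; split=> //.
  by rewrite -mulrA ts mulr1.
have /choice[psi psiP] y : exists x, corr x y.
  have [s Ss [a e]] := quot_loc_repr fP' y; have [t ts] := quot_loc_unit fP Ss.
  exists (f a * t); exists s => //; exists a; split=> //.
  by rewrite -mulrA ts mulr1.
have phi_eq x y : corr x y -> phi x = y.
  by move=> xy; exact: corr_fun fP fP' (phiP x) xy.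
have phiB : zmod_morphism phi.
  move=> x y; apply: phi_eq.
  have [s Ss [a [ea ea']]] := phiP x; have [t St [b [eb eb']]] := phiP y.
  exists (s * t); first exact: mulsetM.
  exists (a * t - b * s); rewrite !rmorphB !rmorphM -ea -ea' -eb -eb'.
  by split; ring.
have phiM : monoid_morphism phi.
  split=> [|x y]; apply: phi_eq.
    by exists 1; [exact: mulset1|exists 1; rewrite !rmorph1 !mulr1].
  have [s Ss [a [ea ea']]] := phiP x; have [t St [b [eb eb']]] := phiP y.
  exists (s * t); first exact: mulsetM.
  exists (a * b); rewrite !rmorphM -ea -ea' -eb -eb'.
  by split; ring.
pose phiZ := GRing.isZmodMorphism.Build R R' phi phiB.
pose phiR := GRing.isMonoidMorphism.Build R R' phi phiM.
pose phi_rmorphism : {rmorphism R -> R'} := HB.pack phi phiZ phiR.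
exists phi_rmorphism; exists psi => [x|y] /=; last exact: phi_eq.
have swap u v : corr u v ->
    exists2 s, S s & exists a, v * f' s = f' a /\ u * f s = f a.
  by move=> [s Ss [a [e e']]]; exists s => //; exists a.
exact: corr_fun fP' fP (swap _ _ (psiP (phi x))) (swap _ _ (phiP x)).
Qed.

(** * Primes of a localization of a quotient *)

Section Spectra.
Variables (A B : comPzRingType) (f : {rmorphism A -> B}).

Section Preimage.
Variable q : spec B.

Lemma preim_spec_proper : ~ preim_ideal f q 1.
Proof. by rewrite /= rmorph1; exact: spec_proper. Qed.

Lemma preim_spec_prime x y :
  preim_ideal f q (x * y) -> preim_ideal f q x \/ preim_ideal f q y.
Proof. by rewrite /= rmorphM; exact: spec_prime. Qed.

Definition preim_spec : spec A := Spec preim_spec_proper preim_spec_prime.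
End Preimage.

(** A fraction lies in the extension exactly when its numerator lies in [q], because elements of [S]
    avoid [q] and cancel; primality is then tested on numerators. *)
Lemma extend_spec (S : mulset A) (K : ideal A) (q : spec A) :
    quot_loc f S K -> K `<=` q -> (forall s, S s -> ~ q s) ->
  exists q' : spec B, q' = extend f q :> set B /\ f @^-1` q' = q.
Proof.
move=> fP Kq Sq.
have qf a : extend f q (f a) <-> q a.
  rewrite (quot_loc_contract fP _ Kq).
  split=> [[s Ss /spec_prime[/(Sq _ Ss)//|//]]|qa].
  by exists 1; [exact: mulset1|rewrite mul1r].
have q1 : ~ extend f q 1 by rewrite -(rmorph1 f) qf; exact: spec_proper.
have qM x y : extend f q (x * y) -> extend f q x \/ extend f q y.
  have [s Ss [a ea]] := quot_loc_repr fP x; have [t St [b eb]] := quot_loc_repr fP y.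
  move=> qxy; have /spec_prime [qa|qb] : q (a * b).
  - apply/qf; rewrite rmorphM -ea -eb.
    by rewrite (_ : _ * _ = f s * f t * (x * y)); [exact: idealMl|ring].
  - by left; apply/(quot_loc_extend fP); exists s => //; exists a.
  - by right; apply/(quot_loc_extend fP); exists t => //; exists b.
exists (Spec q1 qM); split=> //.
by apply/seteqP; split=> a /qf.
Qed.

End Spectra.

(** A fraction outside the extension of [q] has its numerator outside [q], hence is a unit. *)
Lemma quot_loc_local (A R : comPzRingType) (f : {rmorphism A -> R}) (q : spec A)
    (I : ideal A) : I `<=` q -> quot_loc f (spec_compl q) I -> is_local R.
Proof.
move=> Iq fP; have [//|m [mE mq]] := extend_spec fP Iq.
have m_unit x : ~ m x -> exists t, t * x = 1.
  have [s Ss [a e]] := quot_loc_repr fP x; rewrite mE => nmx.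
  have [|t ta] := quot_loc_unit fP (s := a).
    by move=> qa; apply: nmx; apply/(quot_loc_extend fP); exists s => //; exists a.
  by exists (t * f s); rewrite -ta -e; ring.
have sub_m (J : ideal R) : ~ J 1 -> J `<=` m.
  move=> J1 x Jx; apply: contrapT => /m_unit[t tx]; apply: J1.
  by rewrite -tx; exact: idealMl.
exists m; first by split=> [|J _]; [exact: spec_proper|exact: sub_m].
move=> m' [m'1 m'max]; apply/seteqP; split; first exact: sub_m.
by apply: m'max; [exact: sub_m|exact: spec_proper].
Qed.

(** * The property at a prime, and Q0 in terms of primes of the base ring *)

Section Property.
Variable P : comPzRingType -> Prop.
Hypothesis P_iso : iso_invariant P.

(* For [I] contained in [q], this says that [A_q / I A_q] satisfies [P],
   whichever model of that ring is used. *)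
Definition P_at (A : comPzRingType) (I q : set A) : Prop :=
  forall (R : comPzRingType) (f : {rmorphism A -> R}), quot_loc f (~` q) I -> P R.

(** Any two models are isomorphic Noetherian local rings, so by isomorphism invariance one model
    decides. *)
Lemma P_atP (A R : comPzRingType) (f : {rmorphism A -> R}) (q : spec A) (I : ideal A) :
  noetherian A -> I `<=` q -> quot_loc f (~` q) I -> P_at I q <-> P R.
Proof.
move=> noethA Iq fP; split=> [h|PR R' f' fP']; first exact: h fP.
have fP1 : quot_loc f (spec_compl q) I by [].
have fP1' : quot_loc f' (spec_compl q) I by [].
apply: P_iso PR.
- exact: quot_loc_noetherian fP1 _.
- exact: quot_loc_local fP1.
- exact: quot_loc_noetherian fP1' _.
- exact: quot_loc_local fP1'.
- exact: quot_loc_iso fP1 fP1'.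
Qed.

Lemma P_at_loc (A : comPzRingType) (q : spec A) : noetherian A ->
  P_at [set 0] q <-> P (loc_at q).
Proof.
move=> noethA; apply: (@P_atP _ _ (to_loc q) q (zero_ideal A)) => //.
  by move=> _ ->; exact: ideal0.
exact: quot_loc_loc.
Qed.

Lemma P_at_quot_loc (A : comPzRingType) (q : spec A) (I : ideal A) :
  noetherian A -> I `<=` q -> P_at I q <-> P (quot_ring (extend (to_loc q) I)).
Proof.
move=> noethA Iq; apply: P_atP => //.
apply: (@quot_loc_mod _ _ _ (spec_compl q) (zero_ideal A)).
  by move=> _ ->; exact: ideal0.
exact: quot_loc_loc.
Qed.

(** Both sides concern [B_q / J B_q], which is also the localization of [A / f^-1(J)] at
    [f^-1(q)]. *)
Lemma P_at_comp (A B : comPzRingType) (f : {rmorphism A -> B}) (S : mulset A)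
    (I : ideal A) (J : ideal B) (q : spec B) : noetherian A ->
    quot_loc f S I -> J `<=` q ->
  P_at J q <-> P_at (f @^-1` J) (f @^-1` q).
Proof.
move=> noethA fP Jq.
have noethB : noetherian B := quot_loc_noetherian fP noethA.
have gP : quot_loc (to_loc q) (spec_compl q) (zero_ideal B) by exact: quot_loc_loc.
have J0 : zero_ideal B `<=` J by move=> _ ->; exact: ideal0.
have hP := quot_loc_mod J0 gP.
rewrite (P_atP noethB Jq hP); apply: iff_sym.
apply: (@P_atP _ _ (quot (extend (to_loc q) J) \o to_loc q \o f)
  (preim_spec f q) (preim_ideal f J)) => //.
  by move=> a; exact: Jq.
apply: (quot_loc_comp _ fP hP) => s Ss.
have [t ts] := quot_loc_unit fP Ss => qs.
by apply: (@spec_proper _ q); rewrite -ts; exact: idealMl.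
Qed.

Lemma open_basic (A : comPzRingType) (U : set (spec A)) (p : spec A) : open U -> U p ->
  exists2 a, ~ p a & forall q : spec A, ~ q a -> U q.
Proof.
move=> [E ->] /existsNP[a /not_implyP[Ea npa]]; exists a => // q nqa Eq.
exact/nqa/Eq.
Qed.

Lemma basic_open (A : comPzRingType) (a : A) : open [set q : spec A | ~ q a].
Proof.
exists [set a]; apply/seteqP; split=> q /= nqa; last by move=> qa; apply: nqa => _ ->.
by move=> /(_ a erefl).
Qed.

(** The Q0 condition on [A / p], read on the primes of [A] above [p]; the open set is shrunk to a
    basic one, nonempty since [a] is outside [p]. *)
Definition Q0_at (A : comPzRingType) (p : spec A) :=
  exists2 a, ~ p a & forall q : spec A, p `<=` q -> ~ q a -> P_at p q.

Lemma Q0P (A : comPzRingType) : noetherian A -> Q0 P A <-> forall p : spec A, Q0_at p.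
Proof.
move=> noethA.
have quotP (p : spec A) := quot_loc_quot p.
have noethQ (p : spec A) : noetherian (quot_ring p) := quot_loc_noetherian (quotP p) noethA.
have ker (p : spec A) : quot p @^-1` [set 0] = p.
  apply/seteqP; split=> a; rewrite /= (quot_loc_ker (quotP p)).
    by move=> [_ ->]; rewrite mul1r.
  by exists 1 => //; rewrite mul1r.
have Pq (p : spec A) (q : spec (quot_ring p)) : P_at p (quot p @^-1` q) <-> P (loc_at q).
  have q0 : zero_ideal _ `<=` q by move=> _ ->; exact: ideal0.
  by rewrite -(P_at_loc _ (noethQ p)) (P_at_comp noethA (quotP p) q0) ker.
have lift (p q : spec A) : p `<=` q -> exists q' : spec (quot_ring p), quot p @^-1` q' = q.
  move=> pq; have [|q' [_ ?]] := extend_spec (quotP p) pq; last by exists q'.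
  by move=> _ ->; exact: spec_proper.
split=> [hQ p|hQ p].
- have [U [oU [u Uu] UP]] := hQ p.
  have [e ue eU] := open_basic oU Uu.
  exists (quot_repr e).
    rewrite -{1}(ker p) /= quotK => e0; apply: ue; rewrite e0; exact: ideal0.
  move=> q /lift[q' qE] qe; rewrite -qE Pq; apply: UP; apply: eU.
  by rewrite -(quotK e) -[X in ~ X]/((quot p @^-1` q') (quot_repr e)) qE.
- have [a pa aP] := hQ p.
  exists [set q : spec (quot_ring p) | ~ q (quot p a)].
  split=> [||q /= qa]; first exact: basic_open.
    (* The zero ideal of [A / p] belongs to the basic open set. *)
    have [//|q qE] := lift p p; exists q => /= qa; apply: pa.
    by rewrite -qE.
  apply/Pq; apply: (aP (preim_spec (quot p) q)) => // b pb.
  have /= -> : quot p b = 0 by have : p b by []; rewrite -(ker p).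
  exact: ideal0.
Qed.

(** The condition at a prime of [B] is the one at its contraction, with [a] replaced by its
    image. *)
Lemma Q0_quot_loc (A B : comPzRingType) (f : {rmorphism A -> B}) (S : mulset A)
    (I : ideal A) : noetherian A -> quot_loc f S I -> Q0 P A -> Q0 P B.
Proof.
move=> noethA fP; rewrite (Q0P noethA) (Q0P (quot_loc_noetherian fP noethA)) => hQ p.
have [a pa aP] := hQ (preim_spec f p).
exists (f a) => // q pq qa; apply/(P_at_comp noethA fP pq).
by apply: (aP (preim_spec f q)) => // b; exact: pq.
Qed.

End Property.

(** * Nagata's topological criterion *)

(* Noetherian induction on [J]: the complement of [L] in [V(J)] is closed.  For
   [J] prime, either [J] lies outside [L] and the complement is all of [V(J)],
   or it lies in [V(J + (b))] for some [b] outside [J]. *)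
Lemma nagata_open (A : comPzRingType) (L : set (spec A)) : noetherian A ->
    (forall q p : spec A, q `<=` p -> L p -> L q) ->
    (forall p, L p -> exists2 b, ~ p b & forall q : spec A, p `<=` q -> ~ q b -> L q) ->
  open L.
Proof.
move=> noethA gen dense.
have [E EP] : exists E : set A, forall q : spec A,
    ~ L q /\ zero_ideal A `<=` q <-> E `<=` q.
  elim/(noetherian_ind noethA): (zero_ideal A) => J IH.
  have IHa a : ~ J a -> exists E : set A, forall q : spec A,
      ~ L q /\ adjoin J a `<=` q <-> E `<=` q.
    move=> nJa; apply: IH; first exact: sub_adjoin.
    by move/(_ a (adjoin_mem J a)).
  have [J1|nJ1] := pselect (J 1).
    exists setT => q; split=> [[_ /(_ 1 J1) q1]|/(_ 1 I) q1];
      by have := spec_proper q1.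
  have [Jprime|] := pselect (forall x y, J (x * y) -> J x \/ J y); last first.
    (* Here [V(J)] is the union of [V(J + (x))] and [V(J + (y))]; products of equations cut out the
       union of the two closed sets. *)
    move=> /existsNP[x /existsNP[y /not_implyP[Jxy /not_orP[nJx nJy]]]].
    have [E1 E1P] := IHa _ nJx; have [E2 E2P] := IHa _ nJy.
    exists [set z | exists x y, [/\ E1 x, E2 y & z = x * y]] => q; split.
      move=> [nLq Jq] _ [u [v [Eu Ev ->]]].
      have /spec_prime [qx|qy] : q (x * y) by exact: Jq.
        by apply: idealMr; apply: (E1P q).1 Eu; split=> //; exact: adjoin_min.
      by apply: idealMl; apply: (E2P q).1 Ev; split=> //; exact: adjoin_min.
    move=> Eq; have [E1q|] := pselect (E1 `<=` q).
      have [nLq Jq] := (E1P q).2 E1q; split=> // z Jz; apply: Jq.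
      exact: sub_adjoin.
    move=> /existsNP[u /not_implyP[Eu nqu]].
    have [|nLq Jq] := (E2P q).2; last by split=> // z Jz; apply: Jq; exact: sub_adjoin.
    move=> v Ev; have /spec_prime [//|//] : q (u * v) by apply: Eq; exists u, v.
  pose p := Spec nJ1 Jprime.
  have [Lp|nLp] := pselect (L p); last first.
    exists J => q; split=> [[]//|Jq]; split=> // Lq; apply: nLp.
    exact: gen Lq.
  have [b npb bP] := dense p Lp.
  have [E EP] := IHa b npb; exists E => q; rewrite -EP.
  split=> -[nLq Jq]; split=> //; last by move=> z Jz; apply: Jq; exact: sub_adjoin.
  apply: adjoin_min => //; apply: contrapT => nqb; apply: nLq.
  exact: bP.
exists E; apply/seteqP; split=> q /= Lq.
  by move=> /EP[].
apply: contrapT => nLq; apply/Lq/EP; split=> // _ ->; exact: ideal0.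
Qed.

(** * Local nilpotence and generic freeness *)

(** Since [(a, s)^n] lies in [(s) + (a^n)] and [t] kills [a^n], multiplication by [t] maps
    [(a, s)^n] into [(s)]; taking [r]-th powers, [t^r] maps [(a, s)^(rn)] into [(s)^r], which [f]
    kills. *)
Lemma nilpotent_gen (A : comPzRingType) (p : spec A) (s : seq A) :
    {in s, forall a, exists n, exists2 t, ~ p t & t * a ^+ n = 0} ->
  exists r, exists2 f, ~ p f & forall x, ideal_exp (ideal_gen [set` s]) r x -> f * x = 0.
Proof.
elim: s => [|a s IH] h.
  exists 1%N; exists 1; first exact: spec_proper.
  move=> x; rewrite mul1r; apply: (@ideal_mul_min _ _ _ (zero_ideal A)).
  by move=> y z /ideal_gen_nil -> _; rewrite /= mul0r.
have [|r [f nf fr]] := IH; first by move=> b sb; apply: h; rewrite inE sb orbT.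
have [|n [t nt tn]] := h a; first by rewrite inE eqxx.
exists (r * n)%N; exists (f * t ^+ r).
  apply: spec_complM => //; elim: r {fr} => [|r IHr]; first exact: spec_proper.
  by rewrite exprS; exact: spec_complM.
move=> x /ideal_expM; set K := ideal_gen _ => Kx.
rewrite -mulrA; apply: fr; apply: ideal_exp_scale Kx => y.
move/(ideal_expS (@ideal_gen_cons _ a s))/adjoin_exp => [c sc [d ->]].
by rewrite mulrDr mulrCA tn mulr0 addr0; exact: idealMl.
Qed.

Definition ord_cons T (n : nat) (e : T) (m : 'I_n -> T) (j : 'I_n.+1) : T :=
  if unlift ord0 j is Some k then m k else e.

Lemma sum_ord_cons (A : comPzRingType) n (F : 'I_n.+1 -> A) (e : A) (m : 'I_n -> A) :
  \sum_j F j * ord_cons e m j = F ord0 * e + \sum_j F (lift ord0 j) * m j.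
Proof.
rewrite big_ord_recl /ord_cons unlift_none; congr (_ + _).
by apply: eq_bigr => j _; rewrite liftK.
Qed.

(* Generic freeness of [I / I'] over [A / p], for [I] generated by [s] and
   [p I] contained in [I']: a maximal independent subfamily of [s] becomes a
   basis after inverting a suitable [g] outside [p]. *)
Lemma generic_basis (A : comPzRingType) (p : spec A) (I I' : ideal A) (s : seq A) :
    (forall x y, p x -> I y -> I' (x * y)) -> {in s, forall x, I x} ->
  exists n, exists m : 'I_n -> A, exists g, [/\ ~ p g, forall j, I (m j),
    forall c, I' (\sum_j c j * m j) -> forall j, p (c j)
  & forall x, ideal_gen [set` s] x -> exists c, I' (g * x - \sum_j c j * m j)].
Proof.
move=> pI; elim: s => [|e s IH] sI.
  exists 0%N, (fun=> 0), 1; split=> [|[]//|c _ []//|x /ideal_gen_nil ->].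
    exact: spec_proper.
  by exists (fun=> 0); rewrite big_ord0 mulr0 subr0; exact: ideal0.
have [|n [m [g [ng mI indep span]]]] := IH.
  by move=> x sx; apply: sI; rewrite inE sx orbT.
have Ie : I e by apply: sI; rewrite inE eqxx.
(* If every relation has its coefficient of [e] in [p], then [e] joins the independent family. *)
have [new|] := pselect (forall d c, I' (d * e + \sum_j c j * m j) -> p d).
  exists n.+1, (ord_cons e m), g; split=> // [j|c|x].
  - by rewrite /ord_cons; case: unlift.
  - rewrite sum_ord_cons => I'c; have pc0 := new _ _ I'c.
    have I'c' : I' (\sum_j c (lift ord0 j) * m j).
      by have := idealB I'c (pI _ _ pc0 Ie); rewrite addrAC subrr add0r.
    by move=> j; have [k ->|->//] := unliftP ord0 j; exact: (indep (c \o lift ord0)).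
  - move/ideal_gen_cons => [y sy [d ->]]; have [c I'c] := span y sy.
    exists (ord_cons (g * d) c); rewrite sum_ord_cons /ord_cons unlift_none.
    under eq_bigr do rewrite liftK.
    by rewrite (_ : _ - _ = g * y - \sum_j c j * m j) //; ring.
(* Otherwise some relation expresses [d * e] through the [m j] with [d] outside [p], and replacing
   [g] by [g * d] absorbs [e] into the span. *)
move=> /existsNP[d /existsNP[c /not_implyP[I'c npd]]].
exists n, m, (g * d); split=> // [|x]; first exact: spec_complM.
move/ideal_gen_cons => [y sy [d' ->]]; have [c' I'c'] := span y sy.
exists (fun j => d * c' j - d' * g * c j).
have -> : g * d * (y + d' * e) - \sum_j (d * c' j - d' * g * c j) * m j
    = d * (g * y - \sum_j c' j * m j) + d' * g * (d * e + \sum_j c j * m j).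
  under eq_bigr do rewrite mulrBl -!mulrA.
  rewrite sumrB -!mulr_sumr; ring.
by apply: idealD; exact: idealMl.
Qed.

(** The hypotheses express through representatives in [A] that the classes of the [m j] form a
    basis; the isomorphism sends a row to the corresponding combination. *)
Lemma free_graded_piece (A : comPzRingType) (p : ideal A) (i n : nat) (m : 'I_n -> A) :
    (forall j, ideal_exp p i (m j)) ->
    (forall x, ideal_exp p i x ->
       exists c, ideal_exp p i.+1 (x - \sum_j c j * m j)) ->
    (forall c, ideal_exp p i.+1 (\sum_j c j * m j) -> forall j, p (c j)) ->
  free_of_finite_rank (graded_piece p i).
Proof.
move=> mi span indep.
pose M j : power_elt p i := PowerElt (asboolT (mi j)).
pose F (v : 'rV[quot_ring p]_n) : graded_piece p i := \sum_j v 0 j *: gr (M j).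
have F_linear : linear F.
  move=> a u v; rewrite /F scaler_sumr -big_split /=; apply: eq_bigr => j _.
  by rewrite !mxE scalerDl scalerA.
pose comb c : power_elt p i := \sum_j power_scale (c j) (M j).
have valE c : val (comb c) = \sum_j c j * m j.
  by rewrite /comb raddf_sum; apply: eq_bigr.
have FE c : F (\row_j quot p (c j)) = gr (comb c).
  rewrite /F /comb; have gr0 : gr (0 : power_elt p i) = 0 by rewrite /gr raddf0.
  rewrite (big_morph _ (@grD _ p i) gr0); apply: eq_bigr => j _.
  by rewrite mxE; exact: gr_scaleE.
have repr_row (v : 'rV[quot_ring p]_n) : v = \row_j quot p (quot_repr (v 0 j)).
  by apply/rowP => j; rewrite mxE quotK.
pose F_lin : {linear 'rV[quot_ring p]_n -> graded_piece p i} :=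
  HB.pack F (GRing.isLinear.Build _ _ _ _ F F_linear).
have F_inj : injective F.
  move=> u v e; apply/eqP; rewrite -subr_eq0; apply/eqP.
  have : F (u - v) = gr 0.
    by rewrite [LHS](raddfB F_lin) /= e subrr /gr raddf0.
  rewrite [u - v]repr_row FE => /gr_eq; rewrite valE raddf0 addr0 => /indep pc.
  apply/rowP => j; rewrite mxE [RHS]mxE -(rmorph0 (quot p)).
  by apply/quot_eq; rewrite subr0; exact: pc.
have /choice[G GP] x : exists v, F v = x.
  have [c cP] := span _ (power_eltP (gr_repr x)).
  by exists (\row_j quot p (c j)); rewrite FE -[RHS]grK; apply/esym/gr_eq; rewrite valE.
exists n, F_lin; exists G => [v|x] /=; last exact: GP.
by apply: F_inj; rewrite GP.
Qed.

(** * Powers and graded pieces of an extended ideal *)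

Section PowersOfExtension.
Variables (A C : comPzRingType) (f : {rmorphism A -> C}) (S : mulset A) (K : ideal A).
Hypothesis fP : quot_loc f S K.

Lemma ideal_exp_extend (p : ideal A) (J : ideal C) i : J = extend f p :> set C ->
  ideal_exp J i = extend f (ideal_exp p i) :> set C.
Proof.
move=> JE; apply/seteqP; split; elim: i => [|i IH].
- move=> x _; rewrite -[x]mulr1 -(rmorph1 f); apply: idealMl.
  exact: quot_loc_extend_image.
- rewrite ideal_expSn; apply: ideal_mul_min => x y; rewrite JE.
  move=> /(quot_loc_extend fP)[s Ss [a pa ea]] /IH/(quot_loc_extend fP)[t St [b pb eb]].
  apply/(quot_loc_extend fP); exists (s * t); first exact: mulsetM.
  exists (a * b); first exact: ideal_mul_in.
  by rewrite !rmorphM -ea -eb; ring.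
- by [].
- apply: ideal_gen_min => _ [a + <-]; rewrite ideal_expSn.
  apply: (@ideal_mul_min _ _ _ (preim_ideal f (ideal_exp J i.+1))) => x y px py.
  rewrite [preim_ideal _ _ _]/(ideal_exp J i.+1 (f (x * y))) rmorphM ideal_expSn.
  apply: ideal_mul_in; first by rewrite JE; exact: quot_loc_extend_image.
  by apply: IH; exact: quot_loc_extend_image.
Qed.

(** Spanning up to the factor [g] becomes spanning once [g] is a unit; a relation over [C] is
    cleared of denominators, and these avoid the prime [p]. *)
Lemma free_graded_piece_loc (p : spec A) (J : ideal C) i n (m : 'I_n -> A) g :
    J = extend f p :> set C -> K `<=` ideal_exp p i.+1 ->
    (forall s, S s -> ~ p s) -> (exists t, t * f g = 1) ->
    (forall j, ideal_exp p i (m j)) ->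
    (forall c, ideal_exp p i.+1 (\sum_j c j * m j) -> forall j, p (c j)) ->
    (forall x, ideal_exp p i x ->
       exists c, ideal_exp p i.+1 (g * x - \sum_j c j * m j)) ->
  free_of_finite_rank (graded_piece J i).
Proof.
move=> JE Ki Sp [t tg] mi indep span.
have Jexp k := ideal_exp_extend k JE.
apply: (@free_graded_piece _ _ _ _ (f \o m)) => [j|x|v].
- by rewrite Jexp; exact: quot_loc_extend_image.
- rewrite Jexp => /(quot_loc_extend fP)[s Ss [a pa e]].
  have [u us] := quot_loc_unit fP Ss; have [c pc] := span a pa.
  (* [u] inverts the denominator of [x], and [t] inverts [f g]. *)
  exists (fun j => u * t * f (c j)); rewrite Jexp.
  have -> : x - \sum_j u * t * f (c j) * (f \o m) j
      = u * t * f (g * a - \sum_j c j * m j).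
    rewrite rmorphB rmorph_sum mulrBr !rmorphM -e; congr (_ - _).
      transitivity (u * f s * (t * f g) * x); last by ring.
      by rewrite us tg !mul1r.
    by rewrite mulr_sumr; apply: eq_bigr => j _; rewrite /= rmorphM mulrA.
  by apply: idealMl; exact: quot_loc_extend_image.
- have [s Ss [c cP]] := quot_loc_common fP v.
  rewrite Jexp JE => Jv.
  have : extend f (ideal_exp p i.+1) (f (\sum_j c j * m j)).
    have -> : f (\sum_j c j * m j) = f s * \sum_j v j * (f \o m) j.
      rewrite rmorph_sum mulr_sumr; apply: eq_bigr => j _.
      by rewrite rmorphM -cP /=; ring.
    exact: idealMl.
  move=> /(quot_loc_contract fP _ Ki)[w Sw]; rewrite mulr_sumr.
  under eq_bigr do rewrite mulrA.
  move=> /indep pc j; apply/(quot_loc_extend fP); exists s => //.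
  exists (c j) => //; have := pc j => /spec_prime[/(Sp _ Sw)//|//].
Qed.

End PowersOfExtension.

(** * Inverting a single element *)

Section PowersOf.
Variables (A : comPzRingType) (f : A).

Lemma powers_mul x y :
  (exists n, x = f ^+ n) -> (exists n, y = f ^+ n) -> exists n, x * y = f ^+ n.
Proof. by move=> [m ->] [n ->]; exists (m + n)%N; rewrite exprD. Qed.

Definition powers : mulset A :=
  @MulSet A (fun x => exists n, x = f ^+ n) (ex_intro _ 0%N erefl) powers_mul.

Lemma powers_compl (q : spec A) : ~ q f -> forall s, powers s -> ~ q s.
Proof.
move=> nqf _ [n ->]; elim: n => [|n IH]; first exact: spec_proper.
by rewrite exprS; exact: spec_complM.
Qed.

End PowersOf.

(** * Neighbourhoods within [V(p)] inside the locus, from (A-2) and (A-3) *)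

Section Criterion.
Variable P : comPzRingType -> Prop.
Hypothesis P_iso : iso_invariant P.

(** The two ideals become equal after inverting the complement of [q], so the same rings model both
    quotients. *)
Lemma P_at_saturate (A : comPzRingType) (I I' q : set A) :
    I `<=` I' -> (forall a, I' a -> exists2 s, ~ q s & I (s * a)) ->
    (forall x y, ~ q x -> ~ q y -> ~ q (x * y)) ->
  P_at P I q <-> P_at P I' q.
Proof.
move=> II' sat qM; split=> h R g [gu gr gk]; apply: (h R g); split=> // a.
  rewrite gk; split=> [[s Ss /sat[t nt Ia]]|[s Ss /II' Ia]]; last by exists s.
  by exists (t * s); [exact: qM|rewrite -mulrA].
rewrite gk; split=> [[s Ss /II' Ia]|[s Ss /sat[t nt Ia]]]; first by exists s.
by exists (t * s); [exact: qM|rewrite -mulrA].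
Qed.

(* Over [A_f], for a suitable [f] outside [p], the prime [p] is nilpotent with
   free graded pieces, so that (A-3) applies. *)
Lemma locally_nilpotent_case (A : comPzRingType) (p : spec A) (r : nat) (f0 : A) :
    A3 P -> noetherian A -> Q0 P A -> P (loc_at p) -> (0 < r)%N -> ~ p f0 ->
    (forall x, ideal_exp p r x -> f0 * x = 0) ->
  exists2 b, ~ p b & forall q : spec A, p `<=` q -> ~ q b -> P (loc_at q).
Proof.
move=> HA3 noethA HQ Pp r0 nf0 f0r.
have basis i : exists g, ~ p g /\ exists n, exists m : 'I_n -> A,
    [/\ forall j, ideal_exp p i (m j),
    forall c, ideal_exp p i.+1 (\sum_j c j * m j) -> forall j, p (c j)
    & forall x, ideal_exp p i x -> exists c, ideal_exp p i.+1 (g * x - \sum_j c j * m j)].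
  have [s sE] := noethA (ideal_exp p i).
  have [| |n [m [g [ng mi indep span]]]] := @generic_basis A p (ideal_exp p i) (ideal_exp p i.+1) s.
  - by move=> x y; exact: ideal_mul_in.
  - by move=> x sx; rewrite sE; exact: ideal_gen_sub.
  by exists g; split=> //; exists n, m; split=> // x; rewrite sE; exact: span.
have [g gP] := choice basis.
(* Inverting [f0] makes [p^r] vanish; inverting the [g i] with [i < r] makes the graded pieces
   free. *)
pose f := f0 * \prod_(i < r) g i.
have nf : ~ p f.
  apply: spec_complM => //; apply: (big_ind (fun x => ~ p x)) => [||i _].
  - exact: spec_proper.
  - exact: spec_complM.
  - exact: (gP i).1.
pose phi : {rmorphism A -> loc (powers f)} := in_loc (powers f).
have phiP : quot_loc phi (powers f) (zero_ideal A) by exact: quot_loc_loc.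
have zero_sub (R : comPzRingType) (I : ideal R) : zero_ideal R `<=` I.
  by move=> _ ->; exact: ideal0.
have [pC [pCE ppC]] := extend_spec phiP (zero_sub A p) (powers_compl nf).
have noethC := quot_loc_noetherian phiP noethA.
have [u uf] : exists u, u * phi f = 1.
  by apply: (quot_loc_unit phiP); exists 1%N.
(* [A_q] and the localization of [A_f] at [qC] agree: whatever dies in [A_f] is killed by a power of
   [f], which is outside [q]. *)
have locus_loc (q : spec A) (qC : spec (loc (powers f))) : ~ q f -> phi @^-1` qC = q ->
    P (loc_at q) <-> P (loc_at qC).
  move=> nqf qE; rewrite -!P_at_loc // (P_at_comp P_iso noethA phiP (zero_sub _ _)) qE.
  apply: P_at_saturate => [|a|]; last exact: spec_complM.
    by move=> _ ->; exact: rmorph0.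
  move=> /(quot_loc_ker phiP)[s Ss sa]; exists s => //; exact: powers_compl Ss.
have [|||U [oU UpC UP]] := HA3 _ noethC (Q0_quot_loc P_iso noethA phiP HQ) pC _ r r0.
- exact/(locus_loc p).
- apply/seteqP; split=> [x|_ ->]; last exact: ideal0.
  rewrite (ideal_exp_extend phiP _ pCE) => /(quot_loc_extend phiP)[s Ss [a pa e]].
  apply: (quot_loc_inj phiP Ss); rewrite e mul0r.
  have fa : f * a = 0 by rewrite /f mulrAC f0r // mul0r.
  by rewrite -[LHS]mul1r -uf -mulrA -rmorphM fa rmorph0 mulr0.
- move=> i ir; have [_ [n [m [mi indep span]]]] := gP i.
  apply: (free_graded_piece_loc phiP pCE _ (powers_compl nf) _ mi indep span).
    by move=> _ ->; exact: ideal0.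
  (* The inverse of the image of [g i] is [u] times the image of the remaining factors of [f]. *)
  exists (u * phi (f0 * \prod_(j < r | j != Ordinal ir) g j)).
  have fE : f0 * (\prod_(j < r | j != Ordinal ir) g j) * g i = f.
    by rewrite /f -mulrA mulrC [in RHS](bigD1 (Ordinal ir)) //= mulrC [_ * g i]mulrC.
  by rewrite -mulrA -rmorphM fE.
have [c npc cU] := open_basic oU UpC.
have [s Ss [b0 e]] := quot_loc_repr phiP c.
have [a npa aP] := (Q0P P_iso noethA).1 HQ p.
(* A prime avoiding [f] survives in [A_f]; avoiding [b0], the numerator of [c], puts it in the
   neighbourhood given by (A-3); avoiding [a] makes Q0 at [p] applicable. *)
exists (f * a * b0).
  apply: spec_complM; first exact: spec_complM.
  move=> pb0; apply: npc; rewrite pCE; apply/(quot_loc_extend phiP).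
  by exists s => //; exists b0.
move=> q pq nqb.
have nqf : ~ q f by move=> qf; apply: nqb; do 2 apply: idealMr.
have [qC [qCE qqC]] := extend_spec phiP (zero_sub A q) (powers_compl nqf).
rewrite (locus_loc q qC) //; apply: UP.
  apply: cU => qc; apply: nqb; apply: idealMl; rewrite -qqC /= -e; exact: idealMr.
have pqC : pC `<=` qC.
  move=> x; rewrite pCE qCE; apply: ideal_gen_min => _ [y py <-].
  by apply: quot_loc_extend_image; exact: pq.
(* The quotient condition of (A-3) is carried from [A_f] back to [A_q / p A_q], where Q0 supplies
   it. *)
apply/(P_at_quot_loc P_iso noethC pqC).
apply/(P_at_comp P_iso noethA phiP pqC); rewrite ppC qqC.
by apply: aP => // qa; apply: nqb; apply: idealMr; exact: idealMl.
Qed.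

(** Part (iii) of (A-2) reduces the claim to [A_q / I A_q], a localization of [A / I]; there the
    nilpotent case applies, by the radical condition in (i). *)
Lemma locus_dense (A : comPzRingType) (p : spec A) :
    A2 P -> A3 P -> noetherian A -> Q0 P A -> P (loc_at p) ->
  exists2 b, ~ p b & forall q : spec A, p `<=` q -> ~ q b -> P (loc_at q).
Proof.
move=> HA2 HA3 noethA HQ Pp.
have [x [px]] := HA2 A noethA p Pp.
set I := ideal_gen _ => -[[_ rad] [p' p'E Pp'] [W [oW Wp WP]]].
have Ip : I `<=` p by apply: ideal_gen_min => _ /tnthP[i ->]; exact: px.
have quotP := quot_loc_quot I.
have noethB := quot_loc_noetherian quotP noethA.
have p'p a : p' (quot I a) <-> p a.
  split=> [|pa]; last by rewrite p'E; exists a.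
  rewrite p'E => -[b pb] /quot_eq/Ip pba.
  by rewrite (_ : a = b - (b - a)); [exact: idealB|ring].
have [s sE] := noethB p'.
have [|r [f0 nf0 f0r]] := @nilpotent_gen _ p' s.
  move=> y sy; have [a pa <-] : (quot I @` p) y.
    by rewrite -p'E sE; exact: ideal_gen_sub.
  (* By the radical condition a power of [a / 1] lies in [I A_p], so [t * a ^+ n] is in [I] for some
     [t] outside [p]. *)
  have : extend (to_loc p) p (to_loc p a) by exact: quot_loc_extend_image.
  rewrite -rad => -[n]; rewrite -rmorphXn.
  have locP : quot_loc (to_loc p) (spec_compl p) (zero_ideal A) by exact: quot_loc_loc.
  move=> /(quot_loc_contract locP)[_ ->|t npt It]; first exact: ideal0.
  exists n, (quot I t); first by move=> /p'p.
  rewrite -rmorphXn -rmorphM -(rmorph0 (quot I)); apply/quot_eq.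
  by rewrite subr0.
(* The exponent is raised to [r.+1] to make it positive. *)
have [|b' nb' b'P] :=
  locally_nilpotent_case HA3 noethB (Q0_quot_loc P_iso noethA quotP HQ) Pp' (ltn0Sn r) nf0.
  move=> y /ideal_expS_sub yr; apply: f0r.
  by apply: ideal_expS yr; rewrite sE.
have [w npw wW] := open_basic oW Wp.
(* The lift of [b'] controls the image of [q] in [Spec(A / I)], and [w] keeps [q] inside [W]. *)
exists (quot_repr b' * w).
  by apply: spec_complM => // /p'p; rewrite quotK.
move=> q pq nqbw; have Iq : I `<=` q by move=> z /Ip/pq.
apply: WP => //; first by apply: wW => qw; apply: nqbw; exact: idealMl.
apply/(P_at_quot_loc P_iso noethA Iq).
have [|q' [q'E qq']] := extend_spec quotP Iq; first by move=> _ ->; exact: spec_proper.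
have q'0 : zero_ideal _ `<=` q' by move=> _ ->; exact: ideal0.
have IE : quot I @^-1` (zero_ideal (quot_ring I)) = I.
  apply/seteqP; split=> z; rewrite /= (quot_loc_ker quotP).
    by move=> [_ ->]; rewrite mul1r.
  by exists 1 => //; rewrite mul1r.
rewrite -IE -qq'; apply/(P_at_comp P_iso noethA quotP q'0)/(P_at_loc P_iso _ noethB).
apply: b'P => [y|qb].
  by rewrite p'E q'E => -[z pz <-]; apply: quot_loc_extend_image; exact: pq.
by apply: nqbw; apply: idealMr; rewrite -qq' /= quotK.
Qed.

End Criterion.

Theorem proposition4p3 (P : comPzRingType -> Prop)
    (P_iso : iso_invariant P) :
  (NC P -> A3 P) /\ (A1 P -> A2 P -> A3 P -> NC P).
Proof.
split=> [HNC A noethA HQ p Pp r _ _ _|HA1 HA2 HA3 A noethA HQ].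
  by exists (locus P (A:=A)); split=> //; exact: HNC.
apply: nagata_open => // [q p|p Pp]; first exact: HA1.
exact: locus_dense.
Qed.
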